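(* For all integers $m,i$ with $1\leq i\leq m-1$, $$\frac{(i+1)(i+2)(m+i+3)^2}{(m+1-i)(m+2-i)(m+i+2)^2} <\frac{d_{i}^{2}(m)-d_{i-1}(m)d_{i+1}(m)}{d_{i+1}^{2}(m)-d_{i}(m)d_{i+2}(m)}.$$
   Context: For integers $m\ge 0$ and $0\le i\le m$, the Boros-Moll numbers are $$d_i(m)=2^{-2m}\sum_{k=i}^m 2^k\binom{2m-2k}{m-k}\binom{m+k}{k}\binom{k}{i},$$ with the convention $d_i(m)=0$ for $i<0$ or $i>m$. The notation $d_i^{2}(m)$ means $(d_i(m))^2$. *)

(* Defs.v *)
From mathcomp Require Import all_boot all_order all_algebra.

Set Implicit Arguments.
Unset Strict Implicit.
Unset Printing Implicit Defensive.

Import Order.TTheory GRing.Theory Num.Theory.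
Local Open Scope ring_scope.

(* The Boros-Moll number d_i(m).  The sum is empty for i > m, which gives the
   convention d_i(m) = 0 there.  Negative indices i are not represented. *)
Definition boros_moll (m i : nat) : rat :=
  2 ^- (2 * m) *
  \sum_(i <= k < m.+1)
    2 ^+ k * 'C(2 * m - 2 * k, m - k)%:R * 'C(m + k, k)%:R * 'C(k, i)%:R.

(* Main.v *)
(** For fixed m, the sequence e_i = i! d_i(m) satisfies
      e_{i+1} - (2m+1) e_i + (n^2 - (i-1/2)^2) e_{i-1} = 0,  n = m + 1/2.
    Writing e_{i+1} / e_i = n - t_i, this is the first-order recurrence
      t_{i-1} = (n t_i + (i-1/2)^2) / (n + t_i),  t_m = n,
    whose right-hand side is increasing in t_i; descending induction on i gives
      i + 1/2 <= t_i  and  t_i^2 <= m + i^2 + 1/4.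
    Expressing d_{i-1}, d_{i+1} and d_{i+2} through d_i and t_i turns the claim
    into a polynomial inequality in t_i, which follows from these two bounds. *)
Require Import Defs.
From mathcomp Require Import all_boot all_order all_algebra.
From mathcomp Require Import zify ring lra.
Import Order.TTheory GRing.Theory Num.Theory.
Local Open Scope ring_scope.

Set Implicit Arguments.
Unset Strict Implicit.
Unset Printing Implicit Defensive.

(** * Three-term recurrence in i for fixed m *)

Definition bm_weight (m k : nat) : rat :=
  2 ^+ k * 'C(2 * m - 2 * k, m - k)%:R * 'C(m + k, k)%:R.

(** Terms with k < i vanish, so the range of summation can be made independent of i; sums for
    different i then combine term by term. *)
Lemma boros_mollE m i :
  boros_moll m i = 2 ^- (2 * m) * \sum_(k < m.+1) bm_weight m k * 'C(k, i)%:R.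
Proof.
rewrite /boros_moll (@big_nat_widenl _ _ _ i 0) // big_mkcond big_mkord.
congr (_ * _); apply: eq_bigr => k _ /=.
by case: leqP => // ki; rewrite bin_small // mulr0.
Qed.

Lemma central_binS p :
  (p.+1 * 'C(2 * p.+1, p.+1) = 2 * (2 * p).+1 * 'C(2 * p, p))%N.
Proof.
have -> : (2 * p.+1 = (2 * p).+2)%N by rewrite mulnS.
rewrite -mul_bin_diag.
have e : 'C((2 * p).+1, p) = 'C((2 * p).+1, p.+1).
  by rewrite -bin_sub; [congr 'C(_, _)|]; lia.
have := mul_bin_diag (2 * p).+1 p; rewrite /= -e => h.
by rewrite (_ : (2 * p).+2 = 2 * p.+1)%N; [rewrite /= -mulnA -h mulnA|lia].
Qed.

(** Cross-multiplied ratio of consecutive weights: [central_binS] at p = m - k - 1 handles the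
    central binomial, absorption the other one. *)
Lemma bm_weightS m k : (k < m)%N ->
  bm_weight m k.+1 * k.+1%:R * (2 * m%:R - 2 * k%:R - 1)
  = bm_weight m k * (m%:R - k%:R) * (m%:R + k%:R + 1).
Proof.
move=> km; rewrite /bm_weight.
have [p mE] : exists p, m = (k + p.+1)%N by exists (m - k).-1; lia.
have -> : (2 * m - 2 * k.+1 = 2 * p)%N by lia.
have -> : (m - k.+1 = p)%N by lia.
have -> : (2 * m - 2 * k = 2 * p.+1)%N by lia.
have -> : (m - k = p.+1)%N by lia.
have hm : m%:R = k%:R + p%:R + 1 :> rat by rewrite mE natrD -natr1 addrA.
have h1 := congr1 (fun n => n%:R : rat) (central_binS p).
have h2 := congr1 (fun n => n%:R : rat) (mul_bin_diag (m + k).+1 k).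
rewrite addnS exprS; move: h1 h2; rewrite !natrM.
set a := 'C(2 * p.+1, _)%:R; set b := 'C(2 * p, _)%:R.
set c := 'C(m + k, _)%:R; set d := 'C(_.+1, _)%:R.
have -> : (2 * p).+1%:R = 2 * m%:R - 2 * k%:R - 1 :> rat.
  by rewrite hm -natr1 natrM; ring.
have -> : (m + k).+1%:R = m%:R + k%:R + 1 :> rat by rewrite -natr1 natrD.
have -> : p.+1%:R = m%:R - k%:R :> rat by rewrite hm -natr1; ring.
move=> h1 h2.
transitivity (2 ^+ k * (2 * (2 * m%:R - 2 * k%:R - 1) * b) * (k.+1%:R * d)).
  by ring.
by rewrite -h1 -h2; ring.
Qed.

Lemma bin_natrS (k i : nat) :
  i.+1%:R * 'C(k, i.+1)%:R = (k%:R - i%:R) * 'C(k, i)%:R :> rat.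
Proof.
have [ik|ki] := leqP i k; last by rewrite !bin_small ?mulr0 // ltnW.
by rewrite -natrB // -!natrM mul_bin_left.
Qed.

(* Zeilberger-style telescoping: [bm_weight] is hypergeometric in k, so summing
   [bm_weightS] against 'C(k, j) shifts k by one, and the difference between the
   claimed recurrence and this relation vanishes term by term. *)
Lemma boros_moll_rec m j :
  (m%:R - j%:R) * (m%:R + j%:R + 1) * boros_moll m j
  = (j%:R + 1) * (2 * m%:R + 1) * boros_moll m j.+1
    - (j%:R + 1) * (j%:R + 2) * boros_moll m j.+2.
Proof.
rewrite !boros_mollE !(mulrCA _ (2 ^- _)) -mulrBr; congr (_ * _).
rewrite !mulr_sumr -sumrB.
have shift :
  \sum_(k < m.+1)
    bm_weight m k * k%:R * (2 * m%:R + 1 - 2 * k%:R) * 'C(k.-1, j)%:R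
  = \sum_(k < m.+1)
    bm_weight m k * (m%:R - k%:R) * (m%:R + k%:R + 1) * 'C(k, j)%:R.
  (* The factor k kills the first term on the left, m - k the last one on the right. *)
  rewrite big_ord_recl big_ord_recr /= subrr !(mulr0, mul0r) add0r addr0.
  apply: eq_bigr => k _; rewrite -bm_weightS // /bump leq0n add1n /=.
  by congr (_ * _ * _); rewrite -natr1; ring.
apply/eqP; rewrite -subr_eq0 -sumrB; apply/eqP.
move/eqP: shift; rewrite -subr_eq0 -sumrB => /eqP shift.
rewrite -[RHS]oppr0 -[in RHS]shift -sumrN.
apply: eq_bigr => k _.
have h1 := bin_natrS k j; have h2 := bin_natrS k j.+1.
have h0 : k%:R * 'C(k.-1, j)%:R = j.+1%:R * 'C(k, j.+1)%:R :> rat.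
  by rewrite -!natrM mul_bin_diag.
have -> : bm_weight m k * k%:R * (2 * m%:R + 1 - 2 * k%:R) * 'C(k.-1, j)%:R =
   bm_weight m k * (2 * m%:R + 1 - 2 * k%:R) * (k%:R * 'C(k.-1, j)%:R) by ring.
rewrite h0; move: h1 h2; rewrite -!natr1 => h1 h2.
have h3 : (j%:R + 1) * (j%:R + 2) * 'C(k, j.+2)%:R
    = (k%:R - j%:R - 1) * ((k%:R - j%:R) * 'C(k, j)%:R) :> rat.
  rewrite -h1 (_ : (_ - j%:R - 1) = k%:R - (j%:R + 1)); last by ring.
  by rewrite mulrCA -h2; ring.
transitivity (bm_weight m k *
  ((m%:R - j%:R) * (m%:R + j%:R + 1) * 'C(k, j)%:R
   - (2 * m%:R + 1) * ((j%:R + 1) * 'C(k, j.+1)%:R)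
   + (j%:R + 1) * (j%:R + 2) * 'C(k, j.+2)%:R)).
  by ring.
by rewrite h3 h1; ring.
Qed.

(** * Positivity and the bounds on t_i *)

Lemma boros_moll_gt0 m i : (i <= m)%N -> 0 < boros_moll m i.
Proof.
move=> im; rewrite /boros_moll mulr_gt0 ?invr_gt0 ?exprn_gt0 //.
(* The top term k = m alone gives strict positivity. *)
rewrite big_nat_recr //= ltr_wpDl //.
  by apply: sumr_ge0 => k _; rewrite !mulr_ge0 ?exprn_ge0.
by rewrite !subnn bin0 !mulr_gt0 ?exprn_gt0 ?ltr0n ?bin_gt0 // leq_addl.
Qed.

Lemma boros_moll_gt m : boros_moll m m.+1 = 0.
Proof. by rewrite /boros_moll big_geq // mulr0. Qed.

(* The number t_i of the header. *)
Definition bm_gap (m i : nat) : rat :=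
  m%:R + 1 / 2 - (i%:R + 1) * boros_moll m i.+1 / boros_moll m i.

Lemma bm_gap_rec m i : (i < m)%N ->
  bm_gap m i * (m%:R + 1 / 2 + bm_gap m i.+1)
  = (m%:R + 1 / 2) * bm_gap m i.+1 + (i%:R + 1 / 2) ^+ 2.
Proof.
move=> im; have := boros_moll_rec m i; rewrite /bm_gap.
have := boros_moll_gt0 (ltnW im); have := boros_moll_gt0 im.
move: (boros_moll m i) (boros_moll m i.+1) (boros_moll m i.+2) => x y z y0 x0 h.
rewrite -[i.+1%:R]natr1.
have -> : (i%:R + 1 + 1) * z
    = (2 * m%:R + 1) * y
      - (m%:R - i%:R) * (m%:R + i%:R + 1) * x / (i%:R + 1).
  have i0 : (i%:R + 1 : rat) != 0 by rewrite natr1 pnatr_eq0.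
  apply: (mulfI i0); rewrite h; field; exact: i0.
field.
by rewrite !gt_eqF //= ltr_wpDl.
Qed.

Lemma bm_gapmm m : bm_gap m m = m%:R + 1 / 2.
Proof. by rewrite /bm_gap boros_moll_gt mulr0 mul0r subr0. Qed.

(** One step of the descent, with p = i + 1/2, t = t_i and u = t_{i+1}; in these variables m + i^2 +
    1/4 is n + p^2 - p. *)
Lemma gap_step (R : realFieldType) (n p t u : R) :
  1 / 2 <= p -> p + 1 <= n -> p + 1 <= u -> u ^+ 2 <= n + p ^+ 2 + p ->
  t * (n + u) = n * u + p ^+ 2 ->
  p <= t /\ t ^+ 2 <= n + p ^+ 2 - p.
Proof.
move=> p12 pn pu uX tE.
have nu0 : 0 < n + u by lra.
split.
  rewrite -(ler_pM2r nu0) tE -subr_ge0.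
  rewrite (_ : _ - _ = (n - p) * (u - p)); last by ring.
  by apply: mulr_ge0; lra.
rewrite -(ler_pM2r (exprn_gt0 2 nu0)) -exprMn tE -subr_ge0.
(* Only the last summand needs the upper bound on u. *)
rewrite (_ : _ - _ = 2 * n * ((n - p) * (u - p)) + (n - p) * (n + p)
  + (n - p) * (n + p - 1) * (n + p ^+ 2 + p - u ^+ 2)); last by ring.
by rewrite !addr_ge0 // !mulr_ge0 //; lra.
Qed.

Lemma bm_gap_bounds m i : (i <= m)%N ->
  i%:R + 1 / 2 <= bm_gap m i /\ bm_gap m i ^+ 2 <= m%:R + i%:R ^+ 2 + 1 / 4.
Proof.
move=> im; rewrite -(subKn im); move: (m - i)%N (leq_subr i m) => d.
elim: d => [|d IHd] dm.
  by rewrite subn0 bm_gapmm; split; lra.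
have [] := IHd (ltnW dm).
have lt_m : (m - d.+1 < m)%N by lia.
have := bm_gap_rec lt_m.
have -> : ((m - d.+1).+1 = m - d)%N by lia.
have -> : (m - d)%:R = (m - d.+1)%:R + 1 :> rat.
  by rewrite natr1; congr _%:R; lia.
have : (m - d.+1)%:R + 1 <= m%:R :> rat by rewrite natr1 ler_nat.
have : 0 <= (m - d.+1)%:R :> rat by [].
move: (m - d.+1)%:R (bm_gap m (m - d.+1)) (bm_gap m (m - d)) => a t u.
move=> a0 am tE ulo uhi.
by have [] := @gap_step _ (m%:R + 1 / 2) (a + 1 / 2) t u _ _ _ _ tE; lra.
Qed.

(** * The polynomial inequality in t *)

(* Dispatches on syntax because unifying [addr_ge0] with a numeral c%:R would
   unfold c in unary. *)
Ltac poly_pos :=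
  repeat match goal with
  | |- is_true (0 <= _ + _) => apply addr_ge0
  | |- is_true (0 <= _ * _) => apply mulr_ge0
  | |- is_true (0 <= _%:R) => apply ler0n
  | |- is_true (0 < _ + _) => apply ltr_wpDl
  | |- is_true (0 < _%:R) => rewrite ltr0n
  | |- _ => assumption
  end.

(* In [gap_ineq], i = j + 1 and m = i + 1 + k, so that D = m - i, r = i + 1/2
   and n = m + 1/2.  Put d = t^2 - r^2, which lies in [0, D].  Bounding t from
   below by r + 2 r d / (4 r^2 + D) makes the difference of the two sides affine
   in d; its values at d = 0 and d = D (up to positive factors) have only positive
   coefficients in j and k. *)
Lemma gap_ineq_at0 (R : realFieldType) (j k : R) :
  let D := k + 1 in let r := j + 3 / 2 in let n := r + D in
  0 <= j -> 0 <= k ->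
  0 < (D + 2) * (n + r + 1) ^+ 2 * (n ^+ 2 + r ^+ 2 - 1 / 2)
      - (n + r + 2) ^+ 2 * (n + r - 1) * D ^+ 2.
Proof.
move=> D r n j0 k0.
rewrite (_ : _ - _ =
  ((((8 * k + 24) * j + ((8 * k + 104) * k + 208)) * j
    + (((2 * k + 70) * k + 446) * k + 666)) * j
    + (((14 * k + 196) * k + 798) * k + 936)) * j
    + ((((k + 25) * k + 187) * k + 527) * k + 492));
  last by rewrite /n /r /D; field.
by poly_pos.
Qed.

Lemma gap_ineq_atD (R : realFieldType) (j k : R) :
  let D := k + 1 in let r := j + 3 / 2 in let n := r + D in
  let Q := 4 * r ^+ 2 + D in
  0 <= j -> 0 <= k ->
  0 < (D + 2) * (n + r + 1) ^+ 2
        * (n ^+ 2 + r ^+ 2 - 1 / 2 + (r - 1 / 2) * D) * Q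
      - (n + r + 2) ^+ 2 * (n + r - 1)
        * ((D ^+ 2 + (r + 3 / 2) * D) * Q - 4 * n * r * D).
Proof.
move=> D r n Q j0 k0.
rewrite (_ : _ - _ =
  (((((64 * j + (128 * k + 768)) * j
    + ((112 * k + 1288) * k + 3816)) * j
    + (((64 * k + 972) * k + 5272) * k + 10108)) * j
    + ((((24 * k + 444) * k + 3202) * k + 10958) * k + 15120)) * j
    + (((((4 * k + 102) * k + 977) * k + 4632) * k + 11451) * k + 12114)) * j
    + (((((5 * k + 92) * k + 666) * k + 2442) * k + 4761) * k + 4050));
  last by rewrite /Q /n /r /D; field.
by poly_pos.
Qed.

Lemma gap_ineq (R : realFieldType) (j k t : R) :
  let D := k + 1 in let r := j + 3 / 2 in let n := r + D in
  0 <= j -> 0 <= k -> r <= t -> t ^+ 2 <= r ^+ 2 + D ->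
  (n + r + 2) ^+ 2 * (n + r - 1)
    * ((n - t) ^+ 2 + (r + 1 / 2) * (t ^+ 2 - r ^+ 2))
  < (D + 2) * (n + r + 1) ^+ 2
    * (n ^+ 2 + r ^+ 2 - 1 / 2 + (r - 1 / 2) * (t ^+ 2 - r ^+ 2)).
Proof.
move=> D r n j0 k0 rt tX.
have := gap_ineq_at0 j0 k0; have := gap_ineq_atD j0 k0.
rewrite /= -/D -/r -/n; set W1 := (X in 0 < X -> _) => W1_gt0.
set W0 := (X in 0 < X -> _) => W0_gt0.
set A := (n + r + 2) ^+ 2 * (n + r - 1).
set Q := 4 * r ^+ 2 + D.
have D0 : 0 < D by rewrite /D; lra.
have r0 : 0 < r by rewrite /r; lra.
have Q0 : 0 < Q by rewrite /Q addr_gt0 // mulr_gt0 // exprn_gt0.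
have n0 : 0 < n by rewrite /n addr_gt0.
have A0 : 0 <= A by rewrite /A mulr_ge0 ?exprn_ge0 //; rewrite /n /r /D; lra.
set d := t ^+ 2 - r ^+ 2.
have d0 : 0 <= d by rewrite /d subr_ge0 ler_sqr ?nnegrE //; lra.
have dD : 0 <= D - d by rewrite /d; lra.
(* The last summand is the error of the lower bound on t. *)
rewrite -subr_gt0 -(pmulr_rgt0 _ (mulr_gt0 D0 Q0)).
rewrite (_ : D * Q * _ = ((D - d) * Q * W0 + d * W1)
  + D * A * (2 * n) * ((t - r) * (r ^+ 2 + D - t ^+ 2 + (t - r) ^+ 2))).
  apply: ltr_pwDl; last first.
    have tr : 0 <= t - r by rewrite subr_ge0.
    have e0 : 0 <= r ^+ 2 + D - t ^+ 2 + (t - r) ^+ 2.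
      by apply: addr_ge0 (sqr_ge0 _); rewrite subr_ge0.
    have [D1 n1] := (ltW D0, ltW n0).
    have DA := mulr_ge0 (mulr_ge0 D1 A0) (mulr_ge0 (ler0n _ 2) n1).
    exact: mulr_ge0 DA (mulr_ge0 tr e0).
  (* Strictness comes from [W0] at d = 0 and from [W1] otherwise. *)
  have [d00|dn0] := eqVneq d 0.
    by rewrite d00 subr0 mul0r addr0 !mulr_gt0.
  have d_gt0 : 0 < d by rewrite lt_def dn0.
  apply: ltr_wpDl (mulr_gt0 d_gt0 W1_gt0).
  exact: mulr_ge0 (mulr_ge0 dD (ltW Q0)) (ltW W0_gt0).
by rewrite /W0 /W1 /A /Q /d /n; field.
Qed.

(** * Translation back to Boros-Moll numbers *)

Theorem theorem1p5 (m i : nat) (him : (1 <= i <= m - 1)%N) :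
  ((i%:R + 1) * (i%:R + 2) * (m%:R + i%:R + 3) ^+ 2)
    / ((m%:R + 1 - i%:R) * (m%:R + 2 - i%:R) * (m%:R + i%:R + 2) ^+ 2)
  < (boros_moll m i ^+ 2 - boros_moll m (i - 1) * boros_moll m (i + 1))
    / (boros_moll m (i + 1) ^+ 2 - boros_moll m i * boros_moll m (i + 2)).
Proof.
have [j iE] : exists j, i = j.+1 by exists i.-1; lia.
have [k mE] : exists k, m = (j.+1 + k.+1)%N by exists (m - i).-1; lia.
have lejm : (j.+1 <= m)%N by lia.
have ltjm : (j.+2 <= m)%N by lia.
have aE : j.+1%:R = j%:R + 1 :> rat by rewrite natr1.
have ME : m%:R = j%:R + k%:R + 2 :> rat.
  by rewrite mE natrD -[k.+1%:R]natr1 aE; ring.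
have j0 : 0 <= j%:R :> rat by [].
have k0 : 0 <= k%:R :> rat by [].
have [] := bm_gap_bounds lejm; have := erefl (bm_gap m j.+1).
rewrite {2}/bm_gap.
have := boros_moll_rec m j; have := boros_moll_rec m j.+1.
rewrite {}iE subn1 addn1 addn2 /= aE.
have := boros_moll_gt0 lejm; have := boros_moll_gt0 ltjm.
move: (boros_moll m j) (boros_moll m j.+1) (boros_moll m j.+2)
  (boros_moll m j.+3) (bm_gap m j.+1) => x y z w t z0 y0.
move: (m%:R) (j%:R) (k%:R) ME j0 k0 => {aE mE lejm ltjm him} M b c -> {M} b0 c0.
move=> recw recx tE tlo thi.
(* Here b = i - 1 and c = m - i - 1, so r = i + 1/2, n = m + 1/2, and the upper bound on t^2 reads
   r^2 + D with D = c + 1. *)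
pose r := b + 3 / 2; pose n := r + (c + 1).
have key : (n + r + 2) ^+ 2 * (n + r - 1)
    * ((n - t) ^+ 2 + (r + 1 / 2) * (t ^+ 2 - r ^+ 2))
  < (c + 1 + 2) * (n + r + 1) ^+ 2
    * (n ^+ 2 + r ^+ 2 - 1 / 2 + (r - 1 / 2) * (t ^+ 2 - r ^+ 2)).
  by apply: (gap_ineq b0 c0); lra.
have y_neq0 : y != 0 by rewrite gt_eqF.
have zE : z = (n - t) * y / (b + 2).
  by rewrite tE /n /r; field; rewrite y_neq0 gt_eqF //; lra.
have xE : x = (b + 1) * (n + t) * y / ((c + 2) * (2 * b + c + 3)).
  have q0 : (c + 2) * (2 * b + c + 3) != 0.
    by rewrite gt_eqF // mulr_gt0 //; lra.
  apply: (mulfI q0); rewrite [RHS]mulrC divfK //.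
  transitivity ((b + c + 2 - b) * (b + c + 2 + b + 1) * x); first by ring.
  by rewrite recx zE /n /r; field; rewrite gt_eqF //; lra.
have wE : w = (2 * n * (n - t) - (c + 1) * (2 * b + c + 4)) * y
    / ((b + 2) * (b + 3)).
  have q0 : (b + 2) * (b + 3) != 0.
    by rewrite gt_eqF // mulr_gt0 //; lra.
  apply: (mulfI q0); rewrite [RHS]mulrC divfK //.
  transitivity ((b + 1 + 1) * (b + 1 + 2) * w); first by ring.
  apply: (addrI (- ((b + 1 + 1) * (2 * (b + c + 2) + 1) * z))).
  apply: oppr_inj; rewrite opprD opprK -recw zE /n /r; field.
  by rewrite gt_eqF //; lra.
(* Up to explicit positive factors, [E] and [H] are the numerator and denominator of the quotient to
   be bounded. *)
set E := n ^+ 2 + _ - _ + _ in key; set H := (n - t) ^+ 2 + _ in key.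
have numE : y ^+ 2 - x * z
    = y ^+ 2 / ((b + 2) * (c + 2) * (2 * b + c + 3)) * E.
  rewrite xE zE /E /n /r; field.
  by rewrite !gt_eqF //; lra.
have denE : z ^+ 2 - y * w = y ^+ 2 / ((b + 2) ^+ 2 * (b + 3)) * H.
  rewrite wE zE /H /n /r; field.
  by rewrite !gt_eqF //; lra.
have den_gt0 : 0 < z ^+ 2 - y * w.
  have nt0 : 0 < n - t.
    rewrite (_ : n - t = (b + 2) * z / y); last first.
      by rewrite zE; field; rewrite y_neq0 gt_eqF //; lra.
    by rewrite !(mulr_gt0, invr_gt0) //; lra.
  rewrite denE; apply: mulr_gt0.
    by rewrite divr_gt0 ?mulr_gt0 ?exprn_gt0 //; lra.
  rewrite /H ltr_pwDl ?exprn_gt0 // mulr_ge0 //; first by rewrite /r; lra.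
  by rewrite subr_ge0 ler_sqr ?nnegrE /r; lra.
rewrite ltr_pdivlMr // numE denE.
(* The positive factor by which [key] and the cross-multiplied goal differ. *)
pose C := y ^+ 2 / ((b + 2) * (c + 2) * (2 * b + c + 3)
  * ((c + 3) * (2 * b + c + 5) ^+ 2)).
have C_gt0 : 0 < C.
  by rewrite divr_gt0 ?mulr_gt0 ?exprn_gt0 //; lra.
move: key; rewrite -(ltr_pM2l C_gt0); congr (_ < _).
  by rewrite /C /n /r; field; rewrite !gt_eqF //; lra.
by rewrite /C /n /r; field; rewrite !gt_eqF //; lra.
Qed.
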